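(* Let $(\mathcal C,\otimes)$ be a $K$-linear Gray semigroup. Then the $\psi$-equivalence classes of first order unitary tensorator-deformations of $(\mathcal C,\otimes)$ are in bijection with the elements of $H^2_{tens}(\mathcal C)$.
   Context: Conventions. $K$ is a commutative ring with unit. In a (strict) 2-category, $id_X$ is the identity 1-morphism, $1_f$ the identity 2-morphism, $\sigma\cdot\tau$ the vertical composite (first $\tau$), and $\circ$ denotes composition of 1-morphisms ($g\circ f$: first $f$) and horizontal composition of 2-morphisms. A 2-category is $K$-linear if its sets of 2-morphisms are $K$-modules and vertical and horizontal composition are $K$-bilinear. Gray semigroup. A Gray semigroup $(\mathcal C,\otimes)$ is a 2-category $\mathcal C$ with objects $X\otimes Y$, functors $\mathcal C(X,X')\times\mathcal C(Y,Y')\to\mathcal C(X\otimes Y,X'\otimes Y')$ written $(f,g)\mapsto f\otimes g$, $(\tau,\sigma)\mapsto\tau\otimes\sigma$, and 2-isomorphisms $\widehat\otimes((f',g'),(f,g)):(f'\otimes g')\circ(f\otimes g)\Rightarrow(f'\circ f)\otimes(g'\circ g)$, natural in all arguments, such that: $id_X\otimes id_Y=id_{X\otimes Y}$; $\widehat\otimes((f'',g''),(f'\circ f,g'\circ g))\cdot(1_{f''\otimes g''}\circ\widehat\otimes((f',g'),(f,g)))=\widehat\otimes((f''\circ f',g''\circ g'),(f,g))\cdot(\widehat\otimes((f'',g''),(f',g'))\circ1_{f\otimes g})$; $\widehat\otimes((id,id),(f,g))$ and $\widehat\otimes((f,g),(id,id))$ are identities; (cubical) all $\widehat\otimes((f',id),(f,g))$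 and $\widehat\otimes((f,g'),(id,g))$ are identities; $\otimes$ is strictly associative on objects, 1-morphisms and 2-morphisms; and $(\widehat\otimes((f',g'),(f,g))\otimes1_{h'\circ h})\cdot\widehat\otimes((f'\otimes g',h'),(f\otimes g,h))=(1_{f'\circ f}\otimes\widehat\otimes((g',h'),(g,h)))\cdot\widehat\otimes((f',g'\otimes h'),(f,g\otimes h))$. It is $K$-linear if $\mathcal C$ is $K$-linear and $(\tau,\sigma)\mapsto\tau\otimes\sigma$ is $K$-bilinear. Deformations. Let $\mathcal C_\epsilon$ have the same objects and 1-morphisms as $\mathcal C$, with 2-morphisms $\tau_0+\tau_1\epsilon$ ($\tau_0,\tau_1$ parallel 2-morphisms of $\mathcal C$, $\epsilon^2=0$); vertical and horizontal compositions and $\otimes$ of 2-morphisms are extended $K[\epsilon]/(\epsilon^2)$-bilinearly. A first order unitary tensorator-deformation is a family $\widehat\otimes_\epsilon((f',g'),(f,g))=\widehat\otimes((f',g'),(f,g))+\widehat\otimes^{(1)}((f',g'),(f,g))\epsilon$ of 2-isomorphisms of $\mathcal C_\epsilon$ (all other structure, including $id_X\otimes id_Y=id_{X\otimes Y}$ and the trivial associator and pentagonator, being unchanged) defining a semigroupal structure on $\mathcal C_\epsilon$, i.e.: $\widehat\otimes_\epsilon$ is natural; satisfies the same cocycle identity as $\widehat\otimes$ above; $\widehat\otimes_\epsilon((id,id),(f,g))$ and $\widehat\otimes_\epsilon((f,g),(id,id))$ are identities; and $(\widehat\otimes_\epsilon((f',g'),(f,g))\otimes1_{h'h})\cdot\widehat\otimes_\epsilon((f'\otimes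 g',h'),(f\otimes g,h))=(1_{f'f}\otimes\widehat\otimes_\epsilon((g',h'),(g,h)))\cdot\widehat\otimes_\epsilon((f',g'\otimes h'),(f,g\otimes h))$. $\psi$-equivalence. Two such deformations $\widehat\otimes_\epsilon$, $\widehat\otimes'_\epsilon$ are $\psi$-equivalent if the identity 2-functor of $\mathcal C_\epsilon$ admits a semigroupal structure $(\psi,\omega)$ with $\psi_{X,Y}=id_{X\otimes Y}$, $\widehat\psi(f,g)$ the identity mod $\epsilon$, and $\omega$ trivial; explicitly, there are 2-isomorphisms $\widehat\psi(f,g)=1_{f\otimes g}+\widehat\psi^{(1)}(f,g)\epsilon$, natural in $(f,g)$, with $\widehat\psi(id,id)=1$, $\widehat\psi(f'f,g'g)\cdot\widehat\otimes_\epsilon((f',g'),(f,g))=\widehat\otimes'_\epsilon((f',g'),(f,g))\cdot(\widehat\psi(f',g')\circ1_{f\otimes g})\cdot(1_{f'\otimes g'}\circ\widehat\psi(f,g))$, and $(1_f\otimes\widehat\psi(g,h))\cdot\widehat\psi(f,g\otimes h)=(\widehat\psi(f,g)\otimes1_h)\cdot\widehat\psi(f\otimes g,h)$. Double complex. For $m,n\ge1$ let $X^{m-1,n-1}(\mathcal C)$ be the $K$-module of families $\phi$ of 2-morphisms $\phi(f_0,\dots,f_{m-1}):T_0\circ\cdots\circ T_{m-1}\Rightarrow c^1\otimes\cdots\otimes c^n$, one for each sequence of composable $n$-tuples $f_j=(f_j^1,\dots,f_j^n)$ of 1-morphisms ($f_{m-1}$ applied first), where $T_j=f_j^1\otimes\cdots\otimes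 f_j^n$ and $c^k=f_0^k\circ\cdots\circ f_{m-1}^k$, natural with respect to 2-morphisms in all $f_j^k$. Composites $f_{j-1}\circ f_j$ are componentwise. For pairs $p_j=(f_j,g_j)$ put $\Theta_2(p_0)=1$, $\Theta_2(p_0,\dots,p_{m-1})=\widehat\otimes(p_0,p_1\circ\cdots\circ p_{m-1})\cdot(1_{f_0\otimes g_0}\circ\Theta_2(p_1,\dots,p_{m-1}))$. Put $\Theta_1=1$ and $\Theta_n((f_j^1,\dots,f_j^n)_j)=(1_{c^1}\otimes\Theta_{n-1}((f_j^2,\dots,f_j^n)_j))\cdot\Theta_2((f_j^1,f_j^2\otimes\cdots\otimes f_j^n)_j)$ for $n\geq 3$. Define $\delta_h:X^{m-1,n-1}(\mathcal C)\to X^{m,n-1}(\mathcal C)$ by $$(\delta_h\phi)(f_0,\dots,f_m)=\Theta_n(f_0,f_1\circ\cdots\circ f_m)\cdot(1_{T_0}\circ\phi(f_1,\dots,f_m))+\sum_{i=1}^m(-1)^i\phi(\dots,f_{i-1}\circ f_i,\dots)\cdot(1\circ\Theta_n(f_{i-1},f_i)\circ1)+(-1)^{m+1}\Theta_n(f_0\circ\cdots\circ f_{m-1},f_m)\cdot(\phi(f_0,\dots,f_{m-1})\circ1_{T_m}),$$ where the outer $1$'s are identities of the remaining $T_j$'s. Define $\delta_v:X^{m-1,n-1}(\mathcal C)\to X^{m-1,n}(\mathcal C)$, for $f_j=(f_j^0,\dots,f_j^n)$, by $$(\delta_v\phi)(f_0,\dots,f_{m-1})=(1_{c^0}\otimes\phi((f_j^1,\dots,f_j^n)_j))\cdot\Theta_2((f_j^0,f_j^1\otimes\cdots\otimes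 f_j^n)_j)+\sum_{i=1}^n(-1)^i(1\otimes\Theta_2((f_j^{i-1},f_j^i)_j)\otimes1)\cdot\phi((f_j^0,\dots,f_j^{i-1}\otimes f_j^i,\dots,f_j^n)_j)+(-1)^{n+1}(\phi((f_j^0,\dots,f_j^{n-1})_j)\otimes1_{c^n})\cdot\Theta_2((f_j^0\otimes\cdots\otimes f_j^{n-1},f_j^n)_j),$$ where the outer $1$'s are identities of the remaining $c^k$'s. $\phi\in X^{m-1,n-1}(\mathcal C)$ is special if $\phi(f_0,\dots,f_{m-1})=0$ whenever some $f_i=(id,\dots,id)$; the special elements form $X_s^{m-1,n-1}(\mathcal C)$, which is preserved by $\delta_h,\delta_v$. Unitary tensorator-deformation complex. Write $X^n_s(\otimes)=X_s^{n-1,1}(\mathcal C)$ for $n\ge1$. Then $X^n_{tens}(\mathcal C)=\mathrm{Ker}(\delta_v:X^n_s(\otimes)\to X^{n-1,2}_s(\mathcal C))$, $n\ge1$, with coboundary the restriction of $\delta_h$; $H^\bullet_{tens}(\mathcal C)$ denotes its cohomology. *)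

(* Defs.v *)
From mathcomp Require Import all_boot all_order all_algebra.
From mathcomp Require Import boolp.

Set Implicit Arguments.
Unset Strict Implicit.
Unset Printing Implicit Defensive.

Import GRing.Theory.
Local Open Scope ring_scope.

Reserved Notation "g \o1 f" (at level 40, left associativity).
Reserved Notation "b \v2 a" (at level 40, left associativity).
Reserved Notation "b \h2 a" (at level 40, left associativity).
Reserved Notation "X \ox0 Y" (at level 40, left associativity).
Reserved Notation "f \ox1 g" (at level 40, left associativity).
Reserved Notation "a \ox2 b" (at level 40, left associativity).

(* The operations are separated from the axioms so that the axioms on a
   tensorator can be stated once and used both for C and for C_epsilon. *)
Record tensor2Data (K : comPzRingType) := Tensor2Data {
  Ob : Type;
  hom1 : Ob -> Ob -> Type;
  hom2 : forall X Y : Ob, hom1 X Y -> hom1 X Y -> lmodType K;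
  id1 : forall X, hom1 X X;
  comp1 : forall X Y Z, hom1 Y Z -> hom1 X Y -> hom1 X Z;
  id2 : forall X Y (f : hom1 X Y), hom2 f f;
  vcomp : forall X Y (f g h : hom1 X Y), hom2 g h -> hom2 f g -> hom2 f h;
  hcomp : forall X Y Z (g g' : hom1 Y Z) (f f' : hom1 X Y),
    hom2 g g' -> hom2 f f' -> hom2 (comp1 g f) (comp1 g' f');
  tens0 : Ob -> Ob -> Ob;
  tens1 : forall X X' Y Y',
    hom1 X X' -> hom1 Y Y' -> hom1 (tens0 X Y) (tens0 X' Y');
  tens2 : forall X X' Y Y' (f f' : hom1 X X') (g g' : hom1 Y Y'),
    hom2 f f' -> hom2 g g' -> hom2 (tens1 f g) (tens1 f' g') }.

Arguments hom1 {K t} _ _.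
Arguments hom2 {K t X Y} _ _.
Arguments id1 {K t} X.
Arguments comp1 {K t X Y Z} _ _.
Arguments id2 {K t X Y} f.
Arguments vcomp {K t X Y f g h} _ _.
Arguments hcomp {K t X Y Z g g' f f'} _ _.
Arguments tens0 {K t} _ _.
Arguments tens1 {K t X X' Y Y'} _ _.
Arguments tens2 {K t X X' Y Y' f f' g g'} _ _.

Notation "g \o1 f" := (comp1 g f).
Notation "b \v2 a" := (vcomp b a).
Notation "b \h2 a" := (hcomp b a).
Notation "X \ox0 Y" := (tens0 X Y).
Notation "f \ox1 g" := (tens1 f g).
Notation "a \ox2 b" := (tens2 a b).

(* The strict laws equate cells whose boundaries are equal, but not
   convertibly so.  [eq1 f f'] is equality of 1-cells together with their
   source and target; [eq2 a a'] is equality of 2-cells together with their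
   whole boundary. *)
Inductive eq1 K (D : tensor2Data K) (X Y : Ob D) (f : hom1 X Y) :
    forall X' Y' : Ob D, hom1 X' Y' -> Prop :=
  eq1_refl : eq1 f f.

Inductive eq2 K (D : tensor2Data K) (X Y : Ob D) (f g : hom1 X Y)
    (a : hom2 f g) :
    forall (X' Y' : Ob D) (f' g' : hom1 X' Y'), hom2 f' g' -> Prop :=
  eq2_refl : eq2 a a.

Section HeterogeneousEquality.
Variables (K : comPzRingType) (D : tensor2Data K).
Implicit Types X Y Z : Ob D.

Lemma eq1_cast X Y (f : hom1 X Y) X' Y' (f' : hom1 X' Y') : eq1 f f' ->
  forall (eX : X = X') (eY : Y = Y'),
  eq_rect Y (hom1 X') (eq_rect X (hom1^~ Y) f X' eX) Y' eY = f'.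
Proof.
by case=> eX eY; rewrite (Prop_irrelevance eX erefl) (Prop_irrelevance eY erefl).
Qed.

Lemma eq1_eq X Y (f f' : hom1 X Y) : eq1 f f' -> f = f'.
Proof. by move=> /eq1_cast /(_ erefl erefl). Qed.

Lemma eq_eq1 X Y (f f' : hom1 X Y) : f = f' -> eq1 f f'.
Proof. by move->. Qed.

Lemma eq1_sym X Y (f : hom1 X Y) X' Y' (f' : hom1 X' Y') :
  eq1 f f' -> eq1 f' f.
Proof. by case. Qed.

Lemma eq1_trans X Y (f : hom1 X Y) X' Y' (f' : hom1 X' Y')
  X'' Y'' (f'' : hom1 X'' Y'') : eq1 f f' -> eq1 f' f'' -> eq1 f f''.
Proof. by move=> e; case. Qed.

Lemma eq1_tens X Y (f : hom1 X Y) X' Y' (f' : hom1 X' Y')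
    Z W (g : hom1 Z W) Z' W' (g' : hom1 Z' W') :
  eq1 f f' -> eq1 g g' -> eq1 (f \ox1 g) (f' \ox1 g').
Proof. by case; case. Qed.

Lemma eq1_comp X Y Z (g : hom1 Y Z) (f : hom1 X Y)
    X' Y' Z' (g' : hom1 Y' Z') (f' : hom1 X' Y') :
  eq1 g g' -> eq1 f f' -> eq1 (g \o1 f) (g' \o1 f').
Proof.
move=> eg ef.
have eX : X = X' by case: ef.
have eY : Y = Y' by case: ef.
have eZ : Z = Z' by case: eg.
by subst X' Y' Z'; rewrite (eq1_eq eg) (eq1_eq ef).
Qed.

Definition recast X Y (f g : hom1 X Y) X' Y' (f' g' : hom1 X' Y')
    (ef : eq1 f f') (eg : eq1 g g') : hom2 f g -> hom2 f' g' :=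
  match ef in @eq1 _ _ _ _ _ X0 Y0 f0
    return forall g0 : hom1 X0 Y0, eq1 g g0 -> hom2 f g -> hom2 f0 g0 with
  | eq1_refl => fun g0 e a => eq_rect g (hom2 f) a g0 (eq1_eq e)
  end g' eg.

Lemma recastE X Y (f g : hom1 X Y) X' Y' (f' g' : hom1 X' Y')
    (ef : eq1 f f') (eg : eq1 g g') (a : hom2 f g) :
  eq2 (recast ef eg a) a.
Proof. by case: _ _ _ / ef g' eg => g' eg /=; case: _ / (eq1_eq eg). Qed.

End HeterogeneousEquality.

Arguments recast : simpl never.

Section Laws.
Variables (K : comPzRingType) (D : tensor2Data K).

Definition is_id2 (X Y : Ob D) (f g : hom1 X Y) (a : hom2 f g) : Prop :=
  eq2 a (id2 f).

Definition is_iso2 (X Y : Ob D) (f g : hom1 X Y) (a : hom2 f g) : Prop :=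
  exists b : hom2 g f, b \v2 a = id2 f /\ a \v2 b = id2 g.

Record is_2category : Prop := Is2Category {
  comp1A : forall (X Y Z W : Ob D) (h : hom1 Z W) (g : hom1 Y Z) (f : hom1 X Y),
    h \o1 (g \o1 f) = (h \o1 g) \o1 f;
  comp1idl : forall (X Y : Ob D) (f : hom1 X Y), id1 Y \o1 f = f;
  comp1idr : forall (X Y : Ob D) (f : hom1 X Y), f \o1 id1 X = f;
  vcompA : forall (X Y : Ob D) (f g h k : hom1 X Y)
      (c : hom2 h k) (b : hom2 g h) (a : hom2 f g),
    c \v2 (b \v2 a) = (c \v2 b) \v2 a;
  vcompidl : forall (X Y : Ob D) (f g : hom1 X Y) (a : hom2 f g),
    id2 g \v2 a = a;
  vcompidr : forall (X Y : Ob D) (f g : hom1 X Y) (a : hom2 f g),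
    a \v2 id2 f = a;
  hcompA : forall (X Y Z W : Ob D) (h h' : hom1 Z W) (g g' : hom1 Y Z)
      (f f' : hom1 X Y) (c : hom2 h h') (b : hom2 g g') (a : hom2 f f'),
    eq2 (c \h2 (b \h2 a)) ((c \h2 b) \h2 a);
  hcompidl : forall (X Y : Ob D) (f f' : hom1 X Y) (a : hom2 f f'),
    eq2 (id2 (id1 Y) \h2 a) a;
  hcompidr : forall (X Y : Ob D) (f f' : hom1 X Y) (a : hom2 f f'),
    eq2 (a \h2 id2 (id1 X)) a;
  hcomp_id2 : forall (X Y Z : Ob D) (g : hom1 Y Z) (f : hom1 X Y),
    id2 g \h2 id2 f = id2 (g \o1 f);
  interchange : forall (X Y Z : Ob D) (g g' g'' : hom1 Y Z)
      (f f' f'' : hom1 X Y) (b' : hom2 g' g'') (b : hom2 g g')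
      (a' : hom2 f' f'') (a : hom2 f f'),
    (b' \v2 b) \h2 (a' \v2 a) = (b' \h2 a') \v2 (b \h2 a) }.

Definition bilin (U V W : lmodType K) (op : U -> V -> W) : Prop :=
  (forall k u u' v, op (k *: u + u') v = k *: op u v + op u' v) /\
  (forall k u v v', op u (k *: v + v') = k *: op u v + op u v').

Record is_linear2 : Prop := IsLinear2 {
  vcomp_bilin : forall (X Y : Ob D) (f g h : hom1 X Y),
    bilin (@vcomp K D X Y f g h);
  hcomp_bilin : forall (X Y Z : Ob D) (g g' : hom1 Y Z) (f f' : hom1 X Y),
    bilin (@hcomp K D X Y Z g g' f f');
  tens2_bilin : forall (X X' Y Y' : Ob D) (f f' : hom1 X X') (g g' : hom1 Y Y'),
    bilin (@tens2 K D X X' Y Y' f f' g g') }.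

Record is_strict_tensor : Prop := IsStrictTensor {
  tens2_id2 : forall (X X' Y Y' : Ob D) (f : hom1 X X') (g : hom1 Y Y'),
    id2 f \ox2 id2 g = id2 (f \ox1 g);
  tens2_vcomp : forall (X X' Y Y' : Ob D) (f f' f'' : hom1 X X')
      (g g' g'' : hom1 Y Y') (a' : hom2 f' f'') (a : hom2 f f')
      (b' : hom2 g' g'') (b : hom2 g g'),
    (a' \v2 a) \ox2 (b' \v2 b) = (a' \ox2 b') \v2 (a \ox2 b);
  tens1_id1 : forall X Y : Ob D, id1 X \ox1 id1 Y = id1 (X \ox0 Y);
  tens0A : forall X Y Z : Ob D, X \ox0 (Y \ox0 Z) = (X \ox0 Y) \ox0 Z;
  tens1A : forall (X X' Y Y' Z Z' : Ob D)
      (f : hom1 X X') (g : hom1 Y Y') (h : hom1 Z Z'),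
    eq1 (f \ox1 (g \ox1 h)) ((f \ox1 g) \ox1 h);
  tens2A : forall (X X' Y Y' Z Z' : Ob D) (f f' : hom1 X X') (g g' : hom1 Y Y')
      (h h' : hom1 Z Z') (a : hom2 f f') (b : hom2 g g') (c : hom2 h h'),
    eq2 (a \ox2 (b \ox2 c)) ((a \ox2 b) \ox2 c) }.

Definition tensorator : Type :=
  forall (X X' X'' Y Y' Y'' : Ob D)
    (f' : hom1 X' X'') (g' : hom1 Y' Y'') (f : hom1 X X') (g : hom1 Y Y'),
  hom2 ((f' \ox1 g') \o1 (f \ox1 g)) ((f' \o1 f) \ox1 (g' \o1 g)).

Definition tor (t : tensorator) {X X' X'' Y Y' Y'' : Ob D}
    (f' : hom1 X' X'') (g' : hom1 Y' Y'') (f : hom1 X X') (g : hom1 Y Y') :=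
  t X X' X'' Y Y' Y'' f' g' f g.

(* The conditions on a tensorator common to Gray semigroups and to unitary
   deformations; cubicality is only required of the former. *)
Record is_tensorator (t : tensorator) : Prop := IsTensorator {
  tor_iso : forall (X X' X'' Y Y' Y'' : Ob D)
      (f' : hom1 X' X'') (g' : hom1 Y' Y'') (f : hom1 X X') (g : hom1 Y Y'),
    is_iso2 (tor t f' g' f g);
  tor_nat : forall (X X' X'' Y Y' Y'' : Ob D)
      (f' k' : hom1 X' X'') (g' l' : hom1 Y' Y'')
      (f k : hom1 X X') (g l : hom1 Y Y')
      (a' : hom2 f' k') (b' : hom2 g' l') (a : hom2 f k) (b : hom2 g l),
    tor t k' l' k l \v2 ((a' \ox2 b') \h2 (a \ox2 b))
      = ((a' \h2 a) \ox2 (b' \h2 b)) \v2 tor t f' g' f g;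
  tor_cocycle : forall (X X' X'' X''' Y Y' Y'' Y''' : Ob D)
      (f'' : hom1 X'' X''') (g'' : hom1 Y'' Y''')
      (f' : hom1 X' X'') (g' : hom1 Y' Y'') (f : hom1 X X') (g : hom1 Y Y'),
    eq2 (tor t f'' g'' (f' \o1 f) (g' \o1 g)
           \v2 (id2 (f'' \ox1 g'') \h2 tor t f' g' f g))
        (tor t (f'' \o1 f') (g'' \o1 g') f g
           \v2 (tor t f'' g'' f' g' \h2 id2 (f \ox1 g)));
  tor_idl : forall (X X' Y Y' : Ob D) (f : hom1 X X') (g : hom1 Y Y'),
    is_id2 (tor t (id1 X') (id1 Y') f g);
  tor_idr : forall (X X' Y Y' : Ob D) (f : hom1 X X') (g : hom1 Y Y'),
    is_id2 (tor t f g (id1 X) (id1 Y));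
  tor_assoc : forall (X X' X'' Y Y' Y'' Z Z' Z'' : Ob D)
      (f' : hom1 X' X'') (g' : hom1 Y' Y'') (h' : hom1 Z' Z'')
      (f : hom1 X X') (g : hom1 Y Y') (h : hom1 Z Z'),
    eq2 ((tor t f' g' f g \ox2 id2 (h' \o1 h))
           \v2 tor t (f' \ox1 g') h' (f \ox1 g) h)
        ((id2 (f' \o1 f) \ox2 tor t g' h' g h)
           \v2 tor t f' (g' \ox1 h') f (g \ox1 h)) }.

Record is_cubical (t : tensorator) : Prop := IsCubical {
  cubicall : forall (X X' X'' Y Y' : Ob D)
      (f' : hom1 X' X'') (f : hom1 X X') (g : hom1 Y Y'),
    is_id2 (tor t f' (id1 Y') f g);
  cubicalr : forall (X X' Y Y' Y'' : Ob D)
      (f : hom1 X X') (g' : hom1 Y' Y'') (g : hom1 Y Y'),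
    is_id2 (tor t f g' (id1 X) g) }.

End Laws.

Record graySemigroup (K : comPzRingType) := GraySemigroup {
  gdata :> tensor2Data K;
  gtor : tensorator gdata;
  g2cat : is_2category gdata;
  glinear : is_linear2 gdata;
  gstrict : is_strict_tensor gdata;
  gtorP : is_tensorator gtor;
  gcubical : is_cubical gtor }.

(* (a0, a1) stands for a0 + a1 epsilon. *)
Definition Ceps (K : comPzRingType) (D : tensor2Data K) : tensor2Data K :=
  @Tensor2Data K (Ob D) hom1 (fun X Y f g => (hom2 f g * hom2 f g)%type)
    id1 (@comp1 K D)
    (fun X Y f => (id2 f, 0))
    (fun X Y f g h b a =>
       (b.1 \v2 a.1, b.1 \v2 a.2 + b.2 \v2 a.1))
    (fun X Y Z g g' f f' b a =>
       (b.1 \h2 a.1, b.1 \h2 a.2 + b.2 \h2 a.1))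
    tens0 (@tens1 K D)
    (fun X X' Y Y' f f' g g' a b =>
       (a.1 \ox2 b.1, a.1 \ox2 b.2 + a.2 \ox2 b.1)).

Section Deformations.
Variables (K : comPzRingType) (C : graySemigroup K).

Record deformation := Deformation {
  dtor :> tensorator (Ceps C);
  dtor0 : forall (X X' X'' Y Y' Y'' : Ob C)
      (f' : hom1 X' X'') (g' : hom1 Y' Y'') (f : hom1 X X') (g : hom1 Y Y'),
    (tor dtor f' g' f g).1 = tor (@gtor K C) f' g' f g;
  dtorP : is_tensorator dtor }.

Definition psi_family : Type :=
  forall (X X' Y Y' : Ob (Ceps C)) (f : hom1 X X') (g : hom1 Y Y'),
  hom2 (f \ox1 g) (f \ox1 g).

Record is_psi_equiv (t t' : deformation) (psi : psi_family) : Prop :=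
    IsPsiEquiv {
  psi0 : forall (X X' Y Y' : Ob (Ceps C)) (f : hom1 X X') (g : hom1 Y Y'),
    (psi _ _ _ _ f g).1 = id2 (f \ox1 g : @hom1 K C _ _);
  psi_iso : forall (X X' Y Y' : Ob (Ceps C)) (f : hom1 X X') (g : hom1 Y Y'),
    is_iso2 (psi _ _ _ _ f g);
  psi_nat : forall (X X' Y Y' : Ob (Ceps C)) (f k : hom1 X X') (g l : hom1 Y Y')
      (a : hom2 f k) (b : hom2 g l),
    psi _ _ _ _ k l \v2 (a \ox2 b) = (a \ox2 b) \v2 psi _ _ _ _ f g;
  psi_id : forall X Y : Ob (Ceps C), is_id2 (psi _ _ _ _ (id1 X) (id1 Y));
  psi_comp : forall (X X' X'' Y Y' Y'' : Ob (Ceps C))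
      (f' : hom1 X' X'') (g' : hom1 Y' Y'') (f : hom1 X X') (g : hom1 Y Y'),
    psi _ _ _ _ (f' \o1 f) (g' \o1 g) \v2 tor t f' g' f g
      = tor t' f' g' f g
          \v2 (psi _ _ _ _ f' g' \h2 id2 (f \ox1 g))
          \v2 (id2 (f' \ox1 g') \h2 psi _ _ _ _ f g);
  psi_assoc : forall (X X' Y Y' Z Z' : Ob (Ceps C))
      (f : hom1 X X') (g : hom1 Y Y') (h : hom1 Z Z'),
    eq2 ((id2 f \ox2 psi _ _ _ _ g h) \v2 psi _ _ _ _ f (g \ox1 h))
        ((psi _ _ _ _ f g \ox2 id2 h) \v2 psi _ _ _ _ (f \ox1 g) h) }.

Definition psi_equiv (t t' : deformation) : Prop :=
  exists psi : psi_family, is_psi_equiv t t' psi.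

End Deformations.

(* [obn n] is the type of (n+1)-tuples of objects, and similarly for [homn]
   and [hom2n].  [T0], [T1] and [T2] are iterated tensor products, bracketed
   to the right. *)
Section Tuples.
Variables (K : comPzRingType) (D : tensor2Data K).

Fixpoint obn (n : nat) : Type :=
  match n with 0 => Ob D | n'.+1 => (Ob D * obn n')%type end.

Fixpoint homn n : obn n -> obn n -> Type :=
  match n with
  | 0 => fun X Y => hom1 X Y
  | n'.+1 => fun X Y => (hom1 X.1 Y.1 * homn X.2 Y.2)%type
  end.

Fixpoint hom2n n : forall X Y : obn n, homn X Y -> homn X Y -> Type :=
  match n with
  | 0 => fun X Y f g => hom2 f g
  | n'.+1 => fun X Y f g => (hom2 f.1 g.1 * hom2n f.2 g.2)%type
  end.

Fixpoint idn n : forall X : obn n, homn X X :=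
  match n with
  | 0 => fun X => id1 X
  | n'.+1 => fun X => (id1 X.1, idn X.2)
  end.

Fixpoint compn n : forall X Y Z : obn n, homn Y Z -> homn X Y -> homn X Z :=
  match n with
  | 0 => fun X Y Z g f => g \o1 f
  | n'.+1 => fun X Y Z g f => (g.1 \o1 f.1, compn g.2 f.2)
  end.

Fixpoint hcompn n : forall (X Y Z : obn n) (g g' : homn Y Z) (f f' : homn X Y),
    hom2n g g' -> hom2n f f' -> hom2n (compn g f) (compn g' f') :=
  match n with
  | 0 => fun X Y Z g g' f f' b a => b \h2 a
  | n'.+1 => fun X Y Z g g' f f' b a => (b.1 \h2 a.1, hcompn b.2 a.2)
  end.

Fixpoint T0 n : obn n -> Ob D :=
  match n with 0 => fun X => X | n'.+1 => fun X => X.1 \ox0 T0 X.2 end.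

Fixpoint T1 n : forall X Y : obn n, homn X Y -> hom1 (T0 X) (T0 Y) :=
  match n with
  | 0 => fun X Y f => f
  | n'.+1 => fun X Y f => f.1 \ox1 T1 f.2
  end.

Fixpoint T2 n : forall (X Y : obn n) (f g : homn X Y),
    hom2n f g -> hom2 (T1 f) (T1 g) :=
  match n with
  | 0 => fun X Y f g a => a
  | n'.+1 => fun X Y f g a => a.1 \ox2 T2 a.2
  end.

(* [contr i] tensors the components number i and i+1 (counted from 0; the
   last two ones if i is too large). *)
Fixpoint contr0 (i n : nat) {struct n} : obn n.+1 -> obn n :=
  match n with
  | 0 => fun X => X.1 \ox0 X.2
  | n'.+1 => match i with
    | 0 => fun X => (X.1 \ox0 X.2.1, X.2.2)
    | i'.+1 => fun X => (X.1, contr0 i' X.2)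
    end
  end.

Fixpoint contr1 (i n : nat) {struct n} : forall X Y : obn n.+1,
    homn X Y -> homn (contr0 i X) (contr0 i Y) :=
  match n return forall X Y : obn n.+1,
    homn X Y -> homn (contr0 i X) (contr0 i Y) with
  | 0 => fun X Y f => f.1 \ox1 f.2
  | n'.+1 => match i with
    | 0 => fun X Y f => (f.1 \ox1 f.2.1, f.2.2)
    | i'.+1 => fun X Y f => (f.1, contr1 i' f.2)
    end
  end.

Fixpoint butlast0 n : obn n.+1 -> obn n :=
  match n with
  | 0 => fun X => X.1
  | n'.+1 => fun X => (X.1, butlast0 X.2)
  end.

Fixpoint butlast1 n : forall X Y : obn n.+1,
    homn X Y -> homn (butlast0 X) (butlast0 Y) :=
  match n with
  | 0 => fun X Y f => f.1
  | n'.+1 => fun X Y f => (f.1, butlast1 f.2)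
  end.

Fixpoint last0 n : obn n -> Ob D :=
  match n with 0 => fun X => X | n'.+1 => fun X => last0 X.2 end.

Fixpoint last1 n : forall X Y : obn n, homn X Y -> hom1 (last0 X) (last0 Y) :=
  match n with 0 => fun X Y f => f | n'.+1 => fun X Y f => last1 f.2 end.

End Tuples.

Arguments obn {K} D n.

(* [chain Ys X Z] is the type of sequences f_0, ..., f_p of composable
   (n+1)-tuples, f_p applied first, from X to Z through the p intermediate
   objects Ys, listed from the target side:
   X --f_p--> Ys_(p-1) --> ... --> Ys_0 --f_0--> Z. *)
Section Chains.
Variables (K : comPzRingType) (D : tensor2Data K).

Fixpoint obs n (p : nat) : Type :=
  match p with 0 => unit | p'.+1 => (obn D n * obs n p')%type end.

Fixpoint chain n p : obs n p -> obn D n -> obn D n -> Type :=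
  match p with
  | 0 => fun _ X Z => homn X Z
  | p'.+1 => fun Ys X Z => (homn Ys.1 Z * chain Ys.2 X Ys.1)%type
  end.

Fixpoint chain2 n p : forall (Ys : obs n p) (X Z : obn D n),
    chain Ys X Z -> chain Ys X Z -> Type :=
  match p with
  | 0 => fun _ X Z s s' => hom2n s s'
  | p'.+1 => fun Ys X Z s s' => (hom2n s.1 s'.1 * chain2 s.2 s'.2)%type
  end.

Fixpoint ccomp n p : forall (Ys : obs n p) (X Z : obn D n),
    chain Ys X Z -> homn X Z :=
  match p with
  | 0 => fun _ X Z s => s
  | p'.+1 => fun Ys X Z s => compn s.1 (ccomp s.2)
  end.

Fixpoint ccomp2 n p : forall (Ys : obs n p) (X Z : obn D n)
    (s s' : chain Ys X Z), chain2 s s' -> hom2n (ccomp s) (ccomp s') :=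
  match p with
  | 0 => fun _ X Z s s' t => t
  | p'.+1 => fun Ys X Z s s' t => hcompn t.1 (ccomp2 t.2)
  end.

Section Map.
Variables (n n' : nat) (F0 : obn D n -> obn D n').
Variable F1 : forall X Y, homn X Y -> homn (F0 X) (F0 Y).

Fixpoint omap p : obs n p -> obs n' p :=
  match p with 0 => fun _ => tt | p'.+1 => fun Ys => (F0 Ys.1, omap Ys.2) end.

Fixpoint cmap p : forall (Ys : obs n p) (X Z : obn D n),
    chain Ys X Z -> chain (omap Ys) (F0 X) (F0 Z) :=
  match p with
  | 0 => fun _ X Z s => F1 s
  | p'.+1 => fun Ys X Z s => (F1 s.1, cmap s.2)
  end.
End Map.

(* T_0 o ... o T_p *)
Definition Tcomp n p (Ys : obs n p) (X Z : obn D n) (s : chain Ys X Z) :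
    hom1 (T0 X) (T0 Z) :=
  ccomp (cmap (n' := 0) (@T1 K D n) s).

Fixpoint Tcomp2 n p : forall (Ys : obs n p) (X Z : obn D n)
    (s s' : chain Ys X Z), chain2 s s' -> hom2 (Tcomp s) (Tcomp s') :=
  match p with
  | 0 => fun _ X Z s s' t => T2 t
  | p'.+1 => fun Ys X Z s s' t => T2 t.1 \h2 Tcomp2 t.2
  end.

(* The sequences of the first, other, last, and other than last components of
   the tuples, and the sequence of the i-th contracted tuples. *)
Definition chd n p (Ys : obs n.+1 p) (X Z : obn D n.+1) (s : chain Ys X Z) :=
  cmap (n := n.+1) (n' := 0) (F0 := fst) (fun _ _ f => f.1) s.
Definition ctl n p (Ys : obs n.+1 p) (X Z : obn D n.+1) (s : chain Ys X Z) :=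
  cmap (n := n.+1) (n' := n) (F0 := snd) (fun _ _ f => f.2) s.
Definition clast n p (Ys : obs n p) (X Z : obn D n) (s : chain Ys X Z) :=
  cmap (n' := 0) (@last1 K D n) s.
Definition cbutlast n p (Ys : obs n.+1 p) (X Z : obn D n.+1)
    (s : chain Ys X Z) := cmap (@butlast1 K D n) s.
Definition ccontr i n p (Ys : obs n.+1 p) (X Z : obn D n.+1)
    (s : chain Ys X Z) := cmap (@contr1 K D i n) s.

Fixpoint ozip p : obs 0 p -> obs 0 p -> obs 0 p :=
  match p with
  | 0 => fun _ _ => tt
  | p'.+1 => fun Ys Ys' => (Ys.1 \ox0 Ys'.1, ozip Ys.2 Ys'.2)
  end.

Fixpoint czip p : forall (Ys Ys' : obs 0 p) (X Z X' Z' : obn D 0),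
    chain Ys X Z -> chain Ys' X' Z' ->
    chain (ozip Ys Ys') (X \ox0 X' : obn D 0) (Z \ox0 Z' : obn D 0) :=
  match p with
  | 0 => fun _ _ X Z X' Z' a b => a \ox1 b
  | p'.+1 => fun Ys Ys' X Z X' Z' a b => (a.1 \ox1 b.1, czip a.2 b.2)
  end.

(* [cmerge i] composes f_i with f_(i+1) (counted from 0; the last two ones if
   i is too large). *)
Fixpoint odrop n (i p : nat) {struct p} : obs n p.+1 -> obs n p :=
  match p with
  | 0 => fun _ => tt
  | p'.+1 => match i with
    | 0 => fun Ys => Ys.2
    | i'.+1 => fun Ys => (Ys.1, odrop i' Ys.2)
    end
  end.

Fixpoint cmerge n (i p : nat) {struct p} : forall (Ys : obs n p.+1) (X Z : obn D n),
    chain Ys X Z -> chain (odrop i Ys) X Z :=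
  match p return forall (Ys : obs n p.+1) (X Z : obn D n),
    chain Ys X Z -> chain (odrop i Ys) X Z with
  | 0 => fun Ys X Z s => compn s.1 s.2
  | p'.+1 => match i with
    | 0 => fun Ys X Z s => (compn s.1 s.2.1, s.2.2)
    | i'.+1 => fun Ys X Z s => (s.1, cmerge i' s.2)
    end
  end.

Fixpoint oinit n p : obs n p.+1 -> obs n p :=
  match p with
  | 0 => fun _ => tt
  | p'.+1 => fun Ys => (Ys.1, oinit Ys.2)
  end.

Fixpoint oend n p : obs n p.+1 -> obn D n :=
  match p with 0 => fun Ys => Ys.1 | p'.+1 => fun Ys => oend Ys.2 end.

(* f_0, ..., f_p and f_(p+1), for a sequence f_0, ..., f_(p+1) *)
Fixpoint cinit n p : forall (Ys : obs n p.+1) (X Z : obn D n),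
    chain Ys X Z -> chain (oinit Ys) (oend Ys) Z :=
  match p with
  | 0 => fun Ys X Z s => s.1
  | p'.+1 => fun Ys X Z s => (s.1, cinit s.2)
  end.

Fixpoint cend n p : forall (Ys : obs n p.+1) (X Z : obn D n),
    chain Ys X Z -> homn X (oend Ys) :=
  match p with 0 => fun Ys X Z s => s.2 | p'.+1 => fun Ys X Z s => cend s.2 end.

Definition pair_chain n (X Y Z : obn D n) (g : homn Y Z) (f : homn X Y) :
    @chain n 1 (Y, tt) X Z := (g, f).

Inductive is_idn n : forall X Y : obn D n, homn X Y -> Prop :=
  IsIdn (X : obn D n) : is_idn (idn X).

Fixpoint has_id n p : forall (Ys : obs n p) (X Z : obn D n),
    chain Ys X Z -> Prop :=
  match p with
  | 0 => fun _ X Z s => is_idn s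
  | p'.+1 => fun Ys X Z s => is_idn s.1 \/ has_id s.2
  end.

End Chains.

Arguments obs {K} D n p.

Section Boundaries.
Variables (K : comPzRingType) (C : graySemigroup K).

Let comp1A' := comp1A (g2cat C).
Let tens1A' := tens1A (gstrict C).

Lemma compnA n (X Y Z W : obn C n) (h : homn Z W) (g : homn Y Z)
  (f : homn X Y) : compn h (compn g f) = compn (compn h g) f.
Proof.
elim: n X Y Z W h g f => [|n IHn] X Y Z W h g f /=; first exact: comp1A'.
by rewrite comp1A' IHn.
Qed.

Lemma ccomp_cmap n n' (F0 : obn C n -> obn C n')
    (F1 : forall X Y, homn X Y -> homn (F0 X) (F0 Y)) :
    (forall X Y Z (g : homn Y Z) (f : homn X Y),
       F1 _ _ (compn g f) = compn (F1 _ _ g) (F1 _ _ f)) ->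
  forall p (Ys : obs C n p) X Z (s : chain Ys X Z),
  ccomp (cmap F1 s) = F1 _ _ (ccomp s).
Proof.
move=> F1M; elim=> [|p IHp] Ys X Z s //=.
by rewrite IHp F1M.
Qed.

Lemma ccomp_hd n p (Ys : obs C n.+1 p) X Z (s : chain Ys X Z) :
  ccomp (chd s) = (ccomp s).1.
Proof. exact: (@ccomp_cmap n.+1 0 fst (fun X Y f => f.1)). Qed.

Lemma ccomp_tl n p (Ys : obs C n.+1 p) X Z (s : chain Ys X Z) :
  ccomp (ctl s) = (ccomp s).2.
Proof. exact: (@ccomp_cmap n.+1 n snd (fun X Y f => f.2)). Qed.

Lemma ccomp_last n p (Ys : obs C n p) X Z (s : chain Ys X Z) :
  ccomp (clast s) = last1 (ccomp s).
Proof.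
apply: (@ccomp_cmap n 0 (@last0 K C n) (@last1 K C n)) => {p Ys X Z s}.
by elim: n => //= n IHn X Y Z g f; rewrite IHn.
Qed.

Lemma ccomp_butlast n p (Ys : obs C n.+1 p) X Z (s : chain Ys X Z) :
  ccomp (cbutlast s) = butlast1 (ccomp s).
Proof.
apply: ccomp_cmap => {p Ys X Z s}.
by elim: n => //= n IHn X Y Z g f; rewrite IHn.
Qed.

Lemma ccomp_merge n i p (Ys : obs C n p.+1) X Z (s : chain Ys X Z) :
  ccomp (cmerge i s) = ccomp s.
Proof.
elim: p i Ys X Z s => [|p IHp] [|i] Ys X Z s //=; last by rewrite IHp.
by rewrite compnA.
Qed.

Lemma ccomp_init n p (Ys : obs C n p.+1) X Z (s : chain Ys X Z) :
  compn (ccomp (cinit s)) (cend s) = ccomp s.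
Proof.
elim: p Ys X Z s => [|p IHp] Ys X Z s //=.
by rewrite -compnA IHp.
Qed.

Lemma Tcomp_init n p (Ys : obs C n p.+1) X Z (s : chain Ys X Z) :
  Tcomp (cinit s) \o1 T1 (cend s) = Tcomp s.
Proof.
rewrite /Tcomp; elim: p Ys X Z s => [|p IHp] Ys X Z s //=.
by rewrite -comp1A' IHp.
Qed.

Lemma zip_hd_Ttl n p (Ys : obs C n.+1 p) X Z (s : chain Ys X Z) :
  ccomp (czip (chd s) (cmap (n' := 0) (@T1 K C n) (ctl s))) = Tcomp s.
Proof.
rewrite /Tcomp /chd /ctl.
by elim: p Ys X Z s => [|p IHp] Ys X Z s //=; rewrite IHp.
Qed.

Lemma T1_ccomp n p (Ys : obs C n.+1 p) X Z (s : chain Ys X Z) :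
  ccomp (chd s) \ox1 T1 (ccomp (ctl s)) = T1 (ccomp s).
Proof. by rewrite ccomp_hd ccomp_tl. Qed.

Lemma T1_contr i n (X Y : obn C n.+1) (f : homn X Y) :
  eq1 (T1 (contr1 i f)) (T1 f).
Proof.
elim: n i X Y f => [|n IHn] [|i] X Y f //=.
  exact/eq1_sym/tens1A'.
exact: eq1_tens.
Qed.

Lemma T1_butlast n (X Y : obn C n.+1) (f : homn X Y) :
  eq1 (T1 (butlast1 f) \ox1 last1 f) (T1 f).
Proof.
elim: n X Y f => [|n IHn] X Y f //=.
apply: eq1_trans (eq1_sym (tens1A' _ _ _)) _.
by apply: eq1_tens => //; apply: IHn.
Qed.

Lemma Tcomp_contr i n p (Ys : obs C n.+1 p) X Z (s : chain Ys X Z) :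
  eq1 (Tcomp (ccontr i s)) (Tcomp s).
Proof.
rewrite /Tcomp /ccontr; elim: p Ys X Z s => [|p IHp] Ys X Z s /=.
  exact: T1_contr.
by apply: eq1_comp; [exact: T1_contr | exact: IHp].
Qed.

Lemma zip_butlast_last n p (Ys : obs C n.+1 p) X Z (s : chain Ys X Z) :
  eq1 (ccomp (czip (cmap (n' := 0) (@T1 K C n) (cbutlast s)) (clast s)))
      (Tcomp s).
Proof.
rewrite /Tcomp /cbutlast /clast; elim: p Ys X Z s => [|p IHp] Ys X Z s /=.
  exact: (T1_butlast s).
by apply: eq1_comp; [exact: (T1_butlast s.1) | exact: IHp].
Qed.

Lemma T1_ccomp_butlast n p (Ys : obs C n.+1 p) X Z (s : chain Ys X Z) :
  eq1 (T1 (ccomp (cbutlast s)) \ox1 ccomp (clast s)) (T1 (ccomp s)).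
Proof. by rewrite ccomp_butlast ccomp_last; apply: (T1_butlast (ccomp s)). Qed.

Lemma zip_contr1 i p (Ys : obs C 1 p) X Z (s : chain Ys X Z) :
  ccomp (czip (chd s) (ctl s)) = ccomp (ccontr i s).
Proof.
rewrite /chd /ctl /ccontr.
by elim: p Ys X Z s => [|p IHp] Ys X Z s //=; rewrite IHp.
Qed.

Lemma T1_contr0 n p (Ys : obs C n.+2 p) X Z (s : chain Ys X Z) :
  ccomp (czip (chd s) (chd (ctl s))) \ox1 T1 (ccomp (ctl (ctl s)))
    = T1 (ccomp (ccontr 0 s)).
Proof.
rewrite /chd /ctl /ccontr.
suff E : (ccomp (czip (chd s) (chd (ctl s))), ccomp (ctl (ctl s)))
         = ccomp (ccontr 0 s) by rewrite -[ccomp (cmap _ s)]E.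
rewrite /chd /ctl /ccontr.
by elim: p Ys X Z s => [|p IHp] Ys X Z s //=; rewrite -IHp.
Qed.

Lemma T1_contrS i n p (Ys : obs C n.+2 p) X Z (s : chain Ys X Z) :
  ccomp (chd s) \ox1 T1 (ccomp (ccontr i (ctl s)))
    = T1 (ccomp (ccontr i.+1 s)).
Proof.
suff E : (ccomp (chd s), ccomp (ccontr i (ctl s))) = ccomp (ccontr i.+1 s)
  by rewrite -E.
rewrite /chd /ctl /ccontr.
by elim: p Ys X Z s => [|p IHp] Ys X Z s //=; rewrite -IHp.
Qed.

Lemma T1_contr_c1 i p (Ys : obs C 1 p) X Z (s : chain Ys X Z) :
  ccomp (chd s) \ox1 ccomp (ctl s) = T1 (contr1 i (ccomp s)).
Proof. by rewrite ccomp_hd ccomp_tl. Qed.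

Lemma T1_contr_c0 n p (Ys : obs C n.+2 p) X Z (s : chain Ys X Z) :
  (ccomp (chd s) \ox1 ccomp (chd (ctl s))) \ox1 T1 (ccomp (ctl (ctl s)))
    = T1 (contr1 0 (ccomp s)).
Proof. by rewrite !ccomp_hd !ccomp_tl. Qed.

Lemma T1_contr_cS i n p (Ys : obs C n.+2 p) X Z (s : chain Ys X Z) :
  ccomp (chd s) \ox1 T1 (contr1 i (ccomp (ctl s)))
    = T1 (contr1 i.+1 (ccomp s)).
Proof. by rewrite ccomp_hd ccomp_tl. Qed.

Lemma Tcomp0 p (Ys : obs C 0 p) X Z (s : chain Ys X Z) :
  Tcomp s = T1 (ccomp s).
Proof. by rewrite /Tcomp; elim: p Ys X Z s => [|p IHp] Ys X Z s //=; rewrite IHp. Qed.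

End Boundaries.

Section DoubleComplex.
Variables (K : comPzRingType) (C : graySemigroup K).

(* Families of 2-morphisms indexed by sequences of p+1 composable
   (n+1)-tuples: the elements of X^{p,n}(C) are the natural ones. *)
Definition cochain (n p : nat) : Type :=
  forall (Ys : obs C n p) (X Z : obn C n) (s : chain Ys X Z),
  hom2 (Tcomp s) (T1 (ccomp s)).

Definition natural_cochain n p (phi : cochain n p) : Prop :=
  forall (Ys : obs C n p) (X Z : obn C n) (s s' : chain Ys X Z)
    (t : chain2 s s'),
  phi _ _ _ s' \v2 Tcomp2 t = T2 (ccomp2 t) \v2 phi _ _ _ s.

Definition special_cochain n p (phi : cochain n p) : Prop :=
  forall (Ys : obs C n p) (X Z : obn C n) (s : chain Ys X Z),
  has_id s -> phi _ _ _ s = 0.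

(* Theta_2 of the sequence of pairs (a_j, b_j) *)
Fixpoint Theta2 p : forall (Ys Ys' : obs C 0 p) (X Z X' Z' : obn C 0)
    (a : chain Ys X Z) (b : chain Ys' X' Z'),
    @hom2 K C _ _ (ccomp (czip a b)) (ccomp a \ox1 ccomp b) :=
  match p with
  | 0 => fun _ _ X Z X' Z' a b => id2 (a \ox1 b)
  | p'.+1 => fun Ys Ys' X Z X' Z' a b =>
      tor (@gtor K C) a.1 b.1 (ccomp a.2) (ccomp b.2)
        \v2 (id2 (a.1 \ox1 b.1) \h2 Theta2 a.2 b.2)
  end.

(* Theta_(m+2) *)
Fixpoint ThetaSS m p : cochain m.+1 p :=
  match m with
  | 0 => fun Ys X Z s =>
      recast (eq_eq1 (zip_contr1 0 s)) (eq_eq1 (T1_contr_c1 0 s))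
        (Theta2 (chd s) (ctl s))
  | m'.+1 => fun Ys X Z s =>
      recast (eq_eq1 (zip_hd_Ttl s)) (eq_eq1 (T1_ccomp s))
        ((id2 (ccomp (chd s)) \ox2 ThetaSS (ctl s))
           \v2 Theta2 (chd s) (cmap (n' := 0) (@T1 K C m'.+1) (ctl s)))
  end.

(* Theta_(n+1) *)
Definition Theta n p : cochain n p :=
  match n with
  | 0 => fun Ys X Z s =>
      recast (eq1_refl _) (eq_eq1 (Tcomp0 s)) (id2 (Tcomp s))
  | m.+1 => @ThetaSS m p
  end.

(* 1 o Theta_(n+1)(f_i, f_(i+1)) o 1 *)
Fixpoint hwhisk n (i p : nat) {struct p} :
    forall (Ys : obs C n p.+1) (X Z : obn C n) (s : chain Ys X Z),
    hom2 (Tcomp s) (Tcomp (cmerge i s)) :=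
  match p return forall (Ys : obs C n p.+1) (X Z : obn C n) (s : chain Ys X Z),
    hom2 (Tcomp s) (Tcomp (cmerge i s)) with
  | 0 => fun Ys X Z s => Theta (pair_chain s.1 s.2)
  | p'.+1 => match i with
    | 0 => fun Ys X Z s =>
        recast (eq1_sym (eq_eq1 (comp1A (g2cat C) _ _ _))) (eq1_refl _)
          (Theta (pair_chain s.1 s.2.1) \h2 id2 (Tcomp s.2.2))
    | i'.+1 => fun Ys X Z s => id2 (T1 s.1) \h2 hwhisk i' s.2
    end
  end.

Definition delta_h n p (phi : cochain n p) : cochain n p.+1 := fun Ys X Z s =>
  Theta (pair_chain s.1 (ccomp s.2)) \v2 (id2 (T1 s.1) \h2 phi _ _ _ s.2)
  + \sum_(i < p.+1) (-1) ^+ i.+1 *: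
      recast (eq1_refl _) (eq_eq1 (congr1 (@T1 K C n X Z) (ccomp_merge i s)))
        (phi _ _ _ (cmerge i s) \v2 hwhisk i s)
  + (-1) ^+ p.+2 *:
      recast (eq_eq1 (Tcomp_init s))
        (eq_eq1 (congr1 (@T1 K C n X Z) (ccomp_init s)))
        (Theta (pair_chain (ccomp (cinit s)) (cend s))
           \v2 (phi _ _ _ (cinit s) \h2 id2 (T1 (cend s)))).

(* 1 \ox2 Theta_2((f_j^i, f_j^(i+1))_j) \ox2 1 *)
Fixpoint vwhisk (i n p : nat) {struct n} :
    forall (Ys : obs C n.+1 p) (X Z : obn C n.+1) (s : chain Ys X Z),
    hom2 (T1 (ccomp (ccontr i s))) (T1 (contr1 i (ccomp s))) :=
  match n return
    forall (Ys : obs C n.+1 p) (X Z : obn C n.+1) (s : chain Ys X Z),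
    hom2 (T1 (ccomp (ccontr i s))) (T1 (contr1 i (ccomp s))) with
  | 0 => fun Ys X Z s =>
      recast (eq_eq1 (zip_contr1 i s)) (eq_eq1 (T1_contr_c1 i s))
        (Theta2 (chd s) (ctl s))
  | n'.+1 => match i with
    | 0 => fun Ys X Z s =>
        recast (eq_eq1 (T1_contr0 s)) (eq_eq1 (T1_contr_c0 s))
          (Theta2 (chd s) (chd (ctl s)) \ox2 id2 (T1 (ccomp (ctl (ctl s)))))
    | i'.+1 => fun Ys X Z s =>
        recast (eq_eq1 (T1_contrS i' s)) (eq_eq1 (T1_contr_cS i' s))
          (id2 (ccomp (chd s)) \ox2 vwhisk i' (ctl s))
    end
  end.

Definition delta_v n p (phi : cochain n p) : cochain n.+1 p := fun Ys X Z s =>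
  recast (eq_eq1 (zip_hd_Ttl s)) (eq_eq1 (T1_ccomp s))
    ((id2 (ccomp (chd s)) \ox2 phi _ _ _ (ctl s))
       \v2 Theta2 (chd s) (cmap (n' := 0) (@T1 K C n) (ctl s)))
  + \sum_(i < n.+1) (-1) ^+ i.+1 *:
      recast (Tcomp_contr i s) (T1_contr i (ccomp s))
        (vwhisk i s \v2 phi _ _ _ (ccontr i s))
  + (-1) ^+ n.+2 *:
      recast (zip_butlast_last s) (T1_ccomp_butlast s)
        ((phi _ _ _ (cbutlast s) \ox2 id2 (ccomp (clast s)))
           \v2 Theta2 (cmap (n' := 0) (@T1 K C n) (cbutlast s)) (clast s)).

End DoubleComplex.

(* This is the quotient of T by R when R is an equivalence relation. *)
Definition eq_classes (T : Type) (R : T -> T -> Prop) : Type :=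
  {A : T -> Prop | exists x, A = R x}.

Section TensCohomology.
Variables (K : comPzRingType) (C : graySemigroup K).

(* phi is in X^{p+1}_tens(C). *)
Record is_Xtens p (phi : cochain C 1 p) : Prop := IsXtens {
  Xtens_nat : natural_cochain phi;
  Xtens_special : special_cochain phi;
  Xtens_delta_v : forall Ys X Z (s : chain Ys X Z),
    delta_v phi s = 0 }.

Record Ztens p : Type := Cocycle {
  Zval : cochain C 1 p;
  Zval_Xtens : is_Xtens Zval;
  Zval_delta_h : forall Ys X Z (s : chain Ys X Z), delta_h Zval s = 0 }.

(* The complex starts in degree 1, i.e. p = 0. *)
Definition is_Btens p : cochain C 1 p -> Prop :=
  match p with
  | 0 => fun phi => forall Ys X Z (s : chain Ys X Z), phi _ _ _ s = 0
  | p'.+1 => fun phi => exists2 psi : cochain C 1 p', is_Xtens psi &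
      forall Ys X Z (s : chain Ys X Z), phi _ _ _ s = delta_h psi s
  end.

Definition cohomologous p (phi phi' : Ztens p) : Prop :=
  is_Btens (fun Ys X Z s => Zval phi s - Zval phi' s).

(* H^n_tens(C), for n >= 1 *)
Definition Htens (n : nat) : Type := eq_classes (@cohomologous n.-1).

Definition psi_classes : Type := eq_classes (@psi_equiv K C).

End TensCohomology.

(* Main.v *)
(* Write a deformation as t = gtor + phi eps and a psi-equivalence as
   1 + psi eps.  Every axiom holds in degree 0 because it holds in C, and its
   eps-coefficient is a linear condition: naturality and unitality of t say that
   phi is a special natural cochain, the associativity condition that
   delta_v phi = 0 and the cocycle identity that delta_h phi = 0; invertibility
   is automatic.  Likewise 1 + psi eps is an equivalence from phi to phi' iff psi
   is a special natural cochain with delta_v psi = 0 and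
   phi - phi' = delta_h psi. *)
Require Import Defs.
From mathcomp Require Import all_boot all_order all_algebra.
From mathcomp Require Import boolp.

Set Implicit Arguments.
Unset Strict Implicit.
Unset Printing Implicit Defensive.

Import GRing.Theory.
Local Open Scope ring_scope.

(** * Alternating sums and bilinear maps *)

Lemma alternating_sum3 (K : pzRingType) (V : lmodType K) (a b c : V) :
  a + (-1) ^+ 1 *: b + (-1) ^+ 2 *: c = a + c - b.
Proof. by rewrite sqrrN expr1n scale1r scaleN1r addrAC. Qed.

(** A four-term coboundary vanishes when its positive and negative terms have the same sum. Each of
    these two sums will be the eps-coefficient of one side of an axiom. *)
Lemma alternating_sum4_eq0 (K : pzRingType) (V : lmodType K) (a b c d : V) :
  a + ((-1) ^+ 1 *: b + (-1) ^+ 2 *: c) + (-1) ^+ 3 *: d = 0 <->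
  a + c = b + d.
Proof.
have -> : (-1) ^+ 3 = -1 :> K by rewrite exprS sqrrN expr1n mulr1.
rewrite sqrrN expr1n scale1r !scaleN1r [- b + c]addrC addrA.
by rewrite -[_ - b - d]addrA -opprD; split=> [/subr0_eq // | ->]; rewrite subrr.
Qed.

(** The left equation has the shape of the eps-coefficient of [psi_comp]: [p] and [p'] come from the
    two deformations, while [a], [b] and [q] come from psi and make up its three-term coboundary. *)
Lemma addr_subr_iff (V : zmodType) (p p' q a b : V) :
  p + q = a + (b + p') <-> p - p' = a + b - q.
Proof.
rewrite addrA; split=> E; last first.
  by apply: (addIr (- q)); rewrite addrK [_ + p' - q]addrAC -E subrK.
by apply: (addIr p'); rewrite subrK [_ - q + p']addrAC -E addrK.
Qed.

Section Bilinear.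
Variables (K : comPzRingType) (U V W : lmodType K) (op : U -> V -> W).
Hypothesis op_bilin : bilin op.

Lemma bilinDl u u' v : op (u + u') v = op u v + op u' v.
Proof. by case: op_bilin => /(_ 1 u u' v); rewrite !scale1r. Qed.

Lemma bilinDr u v v' : op u (v + v') = op u v + op u v'.
Proof. by case: op_bilin => _ /(_ 1 u v v'); rewrite !scale1r. Qed.

Lemma bilin0l v : op 0 v = 0.
Proof. by apply: (addrI (op 0 v)); rewrite -bilinDl !addr0. Qed.

Lemma bilin0r u : op u 0 = 0.
Proof. by apply: (addrI (op u 0)); rewrite -bilinDr !addr0. Qed.

Lemma bilinNl u v : op (- u) v = - op u v.
Proof. by apply: (addrI (op u v)); rewrite -bilinDl !subrr bilin0l. Qed.

Lemma bilinNr u v : op u (- v) = - op u v.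
Proof. by apply: (addrI (op u v)); rewrite -bilinDr !subrr bilin0r. Qed.

End Bilinear.

(** Both maps pull predicates back, one along [g] and the other along [f], so no representatives are
    chosen. The last two hypotheses say that [S] cannot distinguish [u] from [f (g u)], in either
    argument. *)
Lemma eq_classes_bijective (T U : Type) (R : T -> T -> Prop)
    (S : U -> U -> Prop) (f : T -> U) (g : U -> T) :
    (forall t t', R t t' <-> S (f t) (f t')) ->
    (forall u, S u = S (f (g u))) -> (forall u u', S u u' = S u (f (g u'))) ->
  exists F : eq_classes R -> eq_classes S, bijective F.
Proof.
move=> RS Sl Sr.
have SR u t : S u (f t) = R (g u) t.
  by rewrite Sl; exact: (propext (iff_sym (RS _ _))).
have F_class (A : eq_classes R) : exists u, (fun u' => sval A (g u')) = S u.
  case: A => _ /= [t ->]; exists (f t); apply: funext => u.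
  by rewrite (Sr (f t)); exact: (propext (RS _ _)).
have G_class (B : eq_classes S) : exists t, (fun t' => sval B (f t')) = R t.
  by case: B => _ /= [u ->]; exists (g u); apply: funext => t.
pose F A : eq_classes S := exist _ _ (F_class A).
pose G B : eq_classes R := exist _ _ (G_class B).
exists F; apply: (@Bijective _ _ F G).
  case=> A HA; apply: eq_exist; rewrite /=; case: HA => t0 ->.
  by apply: funext => t; rewrite (propext (RS _ _)) -Sr -(propext (RS _ _)).
case=> B HB; apply: eq_exist; rewrite /=; case: HB => u0 ->.
by apply: funext => u; rewrite -Sr.
Qed.

(** * Calculus of 2-cells with equal but not convertible boundaries *)

Section HeterogeneousEquality.
Variables (K : comPzRingType) (D : tensor2Data K).
Implicit Types X Y Z : Ob D.

Lemma recast_id X Y (f g : hom1 X Y) (ef : eq1 f f) (eg : eq1 g g)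
  (a : hom2 f g) : recast ef eg a = a.
Proof.
rewrite (Prop_irrelevance ef (eq1_refl f)) /recast.
by rewrite (Prop_irrelevance (eq1_eq eg) erefl).
Qed.

Lemma eq2_recast X Y (f g : hom1 X Y) X' Y' (f' g' : hom1 X' Y')
  (a : hom2 f g) (a' : hom2 f' g') :
  eq2 a a' -> forall (ef : eq1 f f') (eg : eq1 g g'), recast ef eg a = a'.
Proof. by case=> ef eg; exact: recast_id. Qed.

(** Transport of [a] along reflexivity proofs gives [a'] by the heterogeneous equality and [a]
    itself by proof irrelevance. *)
Lemma eq2_eq X Y (f g : hom1 X Y) (a a' : hom2 f g) : eq2 a a' -> a = a'.
Proof.
by move=> /eq2_recast /(_ (eq1_refl f) (eq1_refl g)); rewrite recast_id.
Qed.

Lemma eq2_sym X Y (f g : hom1 X Y) X' Y' (f' g' : hom1 X' Y')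
  (a : hom2 f g) (a' : hom2 f' g') : eq2 a a' -> eq2 a' a.
Proof. by case. Qed.

Lemma eq2_trans X Y (f g : hom1 X Y) X' Y' (f' g' : hom1 X' Y')
    X'' Y'' (f'' g'' : hom1 X'' Y'')
    (a : hom2 f g) (a' : hom2 f' g') (a'' : hom2 f'' g'') :
  eq2 a a' -> eq2 a' a'' -> eq2 a a''.
Proof. by move=> e; case. Qed.

Lemma eq2_source X Y (f g : hom1 X Y) X' Y' (f' g' : hom1 X' Y')
  (a : hom2 f g) (a' : hom2 f' g') : eq2 a a' -> eq1 f f'.
Proof. by case. Qed.

Lemma eq2_target X Y (f g : hom1 X Y) X' Y' (f' g' : hom1 X' Y')
  (a : hom2 f g) (a' : hom2 f' g') : eq2 a a' -> eq1 g g'.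
Proof. by case. Qed.

Lemma eq2_add X Y (f g : hom1 X Y) X' Y' (f' g' : hom1 X' Y')
    (a b : hom2 f g) (a' b' : hom2 f' g') :
  eq2 a a' -> eq2 b b' -> eq2 (a + b) (a' + b').
Proof.
by move=> e; case: _ _ _ _ _ / e b' => b' /eq2_eq ->.
Qed.

Lemma eq2_zero X Y (f g : hom1 X Y) X' Y' (f' g' : hom1 X' Y')
    (a : hom2 f g) :
  eq2 a (0 : hom2 f' g') -> a = 0.
Proof.
move=> /eq2_sym; move: {1 3}(0 : hom2 f' g') (erefl (0 : hom2 f' g')) => z ez e.
by case: _ _ _ _ _ / e ez.
Qed.

Lemma eq2_vcomp X Y (f g h : hom1 X Y) X' Y' (f' g' h' : hom1 X' Y')
    (b : hom2 g h) (a : hom2 f g) (b' : hom2 g' h') (a' : hom2 f' g') :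
  eq2 b b' -> eq2 a a' -> eq2 (b \v2 a) (b' \v2 a').
Proof.
move=> e; case: _ _ _ _ _ / e f' a' => f' a' e.
by have /eq1_eq ef := eq2_source e; subst f'; rewrite (eq2_eq e).
Qed.

Lemma eq2_hcomp X Y Z (g k : hom1 Y Z) (f h : hom1 X Y)
    X' Y' Z' (g' k' : hom1 Y' Z') (f' h' : hom1 X' Y')
    (b : hom2 g k) (a : hom2 f h) (b' : hom2 g' k') (a' : hom2 f' h') :
  eq2 b b' -> eq2 a a' -> eq2 (b \h2 a) (b' \h2 a').
Proof.
move=> e; case: _ _ _ _ _ / e f' h' a' => f' h' a' e.
have eX : X = X' by case: e.
subst X'; have /eq1_eq ef := eq2_source e; have /eq1_eq eh := eq2_target e.
by subst f' h'; rewrite (eq2_eq e).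
Qed.

Lemma eq2_tens X Y (f g : hom1 X Y) X' Y' (f' g' : hom1 X' Y')
    Z W (h k : hom1 Z W) Z' W' (h' k' : hom1 Z' W')
    (a : hom2 f g) (a' : hom2 f' g') (b : hom2 h k) (b' : hom2 h' k') :
  eq2 a a' -> eq2 b b' -> eq2 (a \ox2 b) (a' \ox2 b').
Proof. by case; case. Qed.

(** This moves an axiom relating cells with different boundaries into a single module of 2-cells,
    where the recast terms of a coboundary can be added. *)
Lemma eq2_iff_eq X Y (f g : hom1 X Y) X' Y' (f' g' : hom1 X' Y')
    Z W (h k : hom1 Z W) (a : hom2 f g) (a' : hom2 f' g') (b b' : hom2 h k) :
  eq2 b a -> eq2 b' a' -> (eq2 a a' <-> b = b').
Proof.
move=> e e'; split=> [aa' | bb'].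
  exact/eq2_eq/(eq2_trans e)/(eq2_trans aa')/eq2_sym.
by apply: eq2_trans (eq2_sym e) _; rewrite bb'.
Qed.

Lemma eq2_iff_eq_sym X Y (f g : hom1 X Y) X' Y' (f' g' : hom1 X' Y')
    Z W (h k : hom1 Z W) (a : hom2 f g) (a' : hom2 f' g') (b b' : hom2 h k) :
  eq2 b a -> eq2 b' a' -> (eq2 a a' <-> b' = b).
Proof.
move=> e e'; have [eqV eq_eq2] := eq2_iff_eq e' e.
by split=> [/eq2_sym/eqV | /eq_eq2/eq2_sym].
Qed.

End HeterogeneousEquality.

(** * First order calculus in C_epsilon *)

Section FirstOrder.
Variables (K : comPzRingType) (C : graySemigroup K).

Local Notation gt := (tor (@gtor K C)).

(* A heterogeneous equation in C_epsilon which already holds in degree 0 reduces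
   to its eps-coefficient. *)
Lemma eq2_Ceps (X Y : Ob C) (f g : hom1 X Y) (X' Y' : Ob C)
    (f' g' : hom1 X' Y')
    (a : @hom2 K (Ceps C) X Y f g) (a' : @hom2 K (Ceps C) X' Y' f' g') :
  @eq2 K C X Y f g a.1 X' Y' f' g' a'.1 ->
  (eq2 a a' <-> @eq2 K C X Y f g a.2 X' Y' f' g' a'.2).
Proof.
move=> e1; split=> [[] //|].
case: a a' e1 => a1 a2 [a1' a2'] /= e1.
by case: _ _ _ _ _ / e1 a2' => a2' /eq2_eq ->.
Qed.

Lemma eq2_id2 (X Y : Ob C) (f : hom1 X Y) (X' Y' : Ob C) (f' : hom1 X' Y') :
  eq1 f f' -> eq2 (id2 f) (id2 f').
Proof. by case. Qed.

Lemma eq2_vcomp_idl (X Y : Ob C) (f g h : hom1 X Y) (X' Y' : Ob C)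
    (f' g' : hom1 X' Y') (b : hom2 g h) (a : hom2 f g) (a' : hom2 f' g') :
  eq2 b (id2 g') -> eq2 a a' -> eq2 (b \v2 a) a'.
Proof.
by move=> eb ea; rewrite -[a'](vcompidl (g2cat C)); exact: eq2_vcomp.
Qed.

Lemma eq2_vcomp_idr (X Y : Ob C) (f g h : hom1 X Y) (X' Y' : Ob C)
    (g' h' : hom1 X' Y') (b : hom2 g h) (a : hom2 f g) (b' : hom2 g' h') :
  eq2 b b' -> eq2 a (id2 g') -> eq2 (b \v2 a) b'.
Proof.
by move=> eb ea; rewrite -[b'](vcompidr (g2cat C)); exact: eq2_vcomp.
Qed.

Let vbilin := vcomp_bilin (glinear C).
Let hbilin := hcomp_bilin (glinear C).
Let tbilin := tens2_bilin (glinear C).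

Lemma vcompDl (X Y : Ob C) (f g h : hom1 X Y) (b b' : hom2 g h)
  (a : hom2 f g) : (b + b') \v2 a = b \v2 a + b' \v2 a.
Proof. exact: (bilinDl (vbilin f g h)). Qed.

Lemma vcompDr (X Y : Ob C) (f g h : hom1 X Y) (b : hom2 g h)
  (a a' : hom2 f g) : b \v2 (a + a') = b \v2 a + b \v2 a'.
Proof. exact: (bilinDr (vbilin f g h)). Qed.

Lemma vcompNl (X Y : Ob C) (f g h : hom1 X Y) (b : hom2 g h)
  (a : hom2 f g) : (- b) \v2 a = - (b \v2 a).
Proof. exact: (bilinNl (vbilin f g h)). Qed.

Lemma vcompNr (X Y : Ob C) (f g h : hom1 X Y) (b : hom2 g h)
  (a : hom2 f g) : b \v2 (- a) = - (b \v2 a).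
Proof. exact: (bilinNr (vbilin f g h)). Qed.

Section Horizontal.
Variables (X Y Z : Ob C) (g g' : hom1 Y Z) (f f' : hom1 X Y).

Lemma hcompDl (b b' : hom2 g g') (a : hom2 f f') :
  (b + b') \h2 a = b \h2 a + b' \h2 a.
Proof. exact: (bilinDl (hbilin g g' f f')). Qed.

Lemma hcompDr (b : hom2 g g') (a a' : hom2 f f') :
  b \h2 (a + a') = b \h2 a + b \h2 a'.
Proof. exact: (bilinDr (hbilin g g' f f')). Qed.

Lemma hcomp0l (a : hom2 f f') : (0 : hom2 g g') \h2 a = 0.
Proof. exact: (bilin0l (hbilin g g' f f')). Qed.

Lemma hcomp0r (b : hom2 g g') : b \h2 (0 : hom2 f f') = 0.
Proof. exact: (bilin0r (hbilin g g' f f')). Qed.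

End Horizontal.

Section Tensor.
Variables (X X' Y Y' : Ob C) (f f' : hom1 X X') (g g' : hom1 Y Y').

Lemma tens2Dl (a a' : hom2 f f') (b : hom2 g g') :
  (a + a') \ox2 b = a \ox2 b + a' \ox2 b.
Proof. exact: (bilinDl (tbilin f f' g g')). Qed.

Lemma tens2Dr (a : hom2 f f') (b b' : hom2 g g') :
  a \ox2 (b + b') = a \ox2 b + a \ox2 b'.
Proof. exact: (bilinDr (tbilin f f' g g')). Qed.

Lemma tens20l (b : hom2 g g') : (0 : hom2 f f') \ox2 b = 0.
Proof. exact: (bilin0l (tbilin f f' g g')). Qed.

Lemma tens20r (a : hom2 f f') : a \ox2 (0 : hom2 g g') = 0.
Proof. exact: (bilin0r (tbilin f f' g g')). Qed.

End Tensor.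

(** Since eps^2 = 0, the geometric series stops: if [b] is inverse to a_0, then a_0 + a_1 eps has
    inverse b - (b a_1 b) eps. *)
Lemma iso2_Ceps (X Y : Ob C) (f g : hom1 X Y)
    (a : @hom2 K (Ceps C) X Y f g) :
  @is_iso2 K C X Y f g a.1 -> is_iso2 a.
Proof.
case=> b [ba ab]; exists (b, - (b \v2 a.2 \v2 b)).
have idl := vcompidl (g2cat C); have idr := vcompidr (g2cat C).
have vA := vcompA (g2cat C).
split; congr pair; rewrite //=.
  by rewrite vcompNl -!vA ba idr subrr.
by rewrite vcompNr !vA ab idl addNr.
Qed.

(** The inner Theta_2, on a single pair, is an identity, and its whiskering is absorbed. *)
Lemma Theta_pair (X Y Z : obn C 1) (g : homn Y Z) (f : homn X Y) :
  Theta (pair_chain g f) = gt g.1 g.2 f.1 f.2.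
Proof.
apply: eq2_eq; apply: eq2_trans (recastE _ _ _) _ => /=.
by rewrite (hcomp_id2 (g2cat C)) (vcompidr (g2cat C)).
Qed.

Lemma eq2_Theta (X X' X'' Y Y' Y'' : Ob C)
    (f' : hom1 X' X'') (g' : hom1 Y' Y'') (f : hom1 X X') (g : hom1 Y Y') :
  eq2 (Theta (@pair_chain K C 1 (X, Y) (X', Y') (X'', Y'') (f', g') (f, g)))
      (gt f' g' f g).
Proof. by rewrite Theta_pair. Qed.

Lemma eq2_Theta2 (X X' X'' Y Y' Y'' : obn C 0)
    (f' : homn X' X'') (g' : homn Y' Y'') (f : homn X X') (g : homn Y Y') :
  eq2 (Theta2 (pair_chain f' f) (pair_chain g' g)) (gt f' g' f g).
Proof. by rewrite /= (hcomp_id2 (g2cat C)) (vcompidr (g2cat C)). Qed.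

(** * Deformed tensorators and 2-cocycles *)

Definition entry (phi : cochain C 1 1) (X X' X'' Y Y' Y'' : Ob C)
    (f' : hom1 X' X'') (g' : hom1 Y' Y'') (f : hom1 X X') (g : hom1 Y Y') :
    @hom2 K C _ _ ((f' \ox1 g') \o1 (f \ox1 g)) ((f' \o1 f) \ox1 (g' \o1 g)) :=
  phi ((X', Y'), tt) (X, Y) (X'', Y'') ((f', g'), (f, g)).

Definition deform (phi : cochain C 1 1) : tensorator (Ceps C) :=
  fun X X' X'' Y Y' Y'' f' g' f g => (gt f' g' f g, entry phi f' g' f g).

Definition eps_part (t : tensorator (Ceps C)) : cochain C 1 1 :=
  fun Ys X Z s => (tor t s.1.1 s.1.2 s.2.1 s.2.2).2.

Lemma deformK : cancel deform eps_part.
Proof.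
(* Once all tuples are destructured, both sides are convertible. *)
move=> phi; apply: functional_extensionality_dep => -[[Y Y'] []].
apply: functional_extensionality_dep => -[X X'].
apply: functional_extensionality_dep => -[Z Z'].
by apply: functional_extensionality_dep => -[[f' g'] [f g]].
Qed.

Lemma eps_partK (t : deformation C) : deform (eps_part t) = t.
Proof.
do 10!(apply: functional_extensionality_dep => ?).
by rewrite /deform -(dtor0 t); exact/esym/surjective_pairing.
Qed.

(** The eps-parts of the four 2-cells meet only the undeformed tensorator, so their contributions
    cancel by naturality in C. What remains involves the degree 0 parts alone. *)
Lemma deform_nat (phi : cochain C 1 1)
    (X X' X'' Y Y' Y'' : Ob C)
    (f' k' : hom1 X' X'') (g' l' : hom1 Y' Y'')
    (f k : hom1 X X') (g l : hom1 Y Y')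
    (a' : @hom2 K (Ceps C) _ _ f' k') (b' : @hom2 K (Ceps C) _ _ g' l')
    (a : @hom2 K (Ceps C) _ _ f k) (b : @hom2 K (Ceps C) _ _ g l) :
  tor (deform phi) k' l' k l \v2 ((a' \ox2 b') \h2 (a \ox2 b))
    = ((a' \h2 a) \ox2 (b' \h2 b)) \v2 tor (deform phi) f' g' f g <->
  entry phi k' l' k l
      \v2 @hcomp K C _ _ _ _ _ _ _ (a'.1 \ox2 b'.1) (a.1 \ox2 b.1)
    = @tens2 K C _ _ _ _ _ _ _ _ (a'.1 \h2 a.1) (b'.1 \h2 b.1)
      \v2 entry phi f' g' f g.
Proof.
have N := tor_nat (gtorP C).
case: a' b' a b => [a'0 a'1] [b'0 b'1] [a0 a1] [b0 b1] /=.
rewrite !(hcompDl, hcompDr, tens2Dl, tens2Dr, vcompDl, vcompDr) !N.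
rewrite [X in (_, X + _)]addrACA [X in (_, X) = _]addrC.
by split=> [[=]|-> //]; move/addIr.
Qed.

(** Each side of the cocycle identity contains two tensorators and so contributes two eps-terms.
    Those of the left side are the positive terms of [delta_h phi], those of the right side the
    negative ones. *)
Lemma deform_cocycle (phi : cochain C 1 1)
    (X X' X'' X''' Y Y' Y'' Y''' : Ob (Ceps C))
    (f'' : hom1 X'' X''') (g'' : hom1 Y'' Y''')
    (f' : hom1 X' X'') (g' : hom1 Y' Y'') (f : hom1 X X') (g : hom1 Y Y') :
  eq2 (tor (deform phi) f'' g'' (f' \o1 f) (g' \o1 g)
         \v2 (id2 (f'' \ox1 g'') \h2 tor (deform phi) f' g' f g))
      (tor (deform phi) (f'' \o1 f') (g'' \o1 g') f g
         \v2 (tor (deform phi) f'' g'' f' g' \h2 id2 (f \ox1 g))) <->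
  delta_h phi (((f'', g''), ((f', g'), (f, g))) :
    @chain K C 1 2 ((X'', Y''), ((X', Y'), tt)) (X, Y) (X''', Y''')) = 0.
Proof.
apply: iff_trans (eq2_Ceps _) _.
  exact: (tor_cocycle (gtorP C) f'' g'' f' g' f g).
rewrite /= hcomp0l hcomp0r addr0 add0r.
rewrite /delta_h !big_ord_recl big_ord0 addr0 alternating_sum4_eq0.
rewrite !Theta_pair.
apply: eq2_iff_eq.
  apply: eq2_add => //; apply: eq2_trans (recastE _ _ _) _.
  apply: eq2_vcomp => //=; apply: eq2_hcomp => //; exact: eq2_Theta.
(* The composite in C_epsilon lists first the term deformed in its inner factor, the opposite of the
   order in [delta_h]. *)
rewrite addrC; apply: eq2_add; apply: eq2_trans (recastE _ _ _) _ => //.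
apply: eq2_vcomp => //=; apply: eq2_trans (recastE _ _ _) _.
by apply: eq2_hcomp => //; exact: eq2_Theta.
Qed.

(** The positive terms of [delta_v phi] come from the right side of the axiom this time, and the
    negative ones from the left side; hence the symmetric transfer lemma in the proof. *)
Lemma deform_assoc (phi : cochain C 1 1)
    (X X' X'' Y Y' Y'' Z Z' Z'' : Ob (Ceps C))
    (f' : hom1 X' X'') (g' : hom1 Y' Y'') (h' : hom1 Z' Z'')
    (f : hom1 X X') (g : hom1 Y Y') (h : hom1 Z Z') :
  eq2 ((tor (deform phi) f' g' f g \ox2 id2 (h' \o1 h))
         \v2 tor (deform phi) (f' \ox1 g') h' (f \ox1 g) h)
      ((id2 (f' \o1 f) \ox2 tor (deform phi) g' h' g h)
         \v2 tor (deform phi) f' (g' \ox1 h') f (g \ox1 h)) <->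
  delta_v phi (((f', (g', h')), (f, (g, h))) :
    @chain K C 2 1 ((X', (Y', Z')), tt) (X, (Y, Z)) (X'', (Y'', Z''))) = 0.
Proof.
apply: iff_trans (eq2_Ceps _) _.
  exact: (tor_assoc (gtorP C) f' g' h' f g h).
rewrite /= tens20l tens20r addr0 add0r.
rewrite /delta_v !big_ord_recl big_ord0 addr0 alternating_sum4_eq0.
apply: eq2_iff_eq_sym.
  apply: eq2_add; apply: eq2_trans (recastE _ _ _) _; apply: eq2_vcomp => //.
    apply: eq2_trans (recastE _ _ _) _.
    by apply: eq2_tens => //; exact: eq2_Theta2.
  exact: eq2_Theta2.
rewrite addrC; apply: eq2_add; apply: eq2_trans (recastE _ _ _) _;
  apply: eq2_vcomp => //.
  apply: eq2_trans (recastE _ _ _) _; apply: eq2_tens => //.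
  apply: eq2_trans (recastE _ _ _) _; exact: eq2_Theta2.
exact: eq2_Theta2.
Qed.

Lemma is_id2_Ceps (X Y : Ob (Ceps C)) (f g : hom1 X Y)
    (a : @hom2 K (Ceps C) _ _ f g) :
  @is_id2 K C _ _ _ _ a.1 -> (is_id2 a <-> a.2 = 0).
Proof.
move=> e.
have E := @eq2_Ceps _ _ _ _ _ _ _ _ a (id2 (f : @hom1 K (Ceps C) _ _)) e.
apply: iff_trans E _; split=> [/eq2_zero // | ->].
by have /eq1_eq eg := eq2_target e; subst g.
Qed.

Lemma deform_idl (phi : cochain C 1 1) (X X' Y Y' : Ob (Ceps C))
    (f : hom1 X X') (g : hom1 Y Y') :
  is_id2 (tor (deform phi) (id1 X') (id1 Y') f g) <->
  entry phi (id1 X') (id1 Y') f g = 0.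
Proof. by apply: is_id2_Ceps; exact: (tor_idl (gtorP C) f g). Qed.

Lemma deform_idr (phi : cochain C 1 1) (X X' Y Y' : Ob (Ceps C))
    (f : hom1 X X') (g : hom1 Y Y') :
  is_id2 (tor (deform phi) f g (id1 X) (id1 Y)) <->
  entry phi f g (id1 X) (id1 Y) = 0.
Proof. by apply: is_id2_Ceps; exact: (tor_idr (gtorP C) f g). Qed.

(** The axioms are matched one by one. Speciality splits into the two unit axioms, according to
    which of the two pairs is an identity, and invertibility depends only on degree 0. *)
Lemma deform_tensorator (phi : cochain C 1 1) :
  is_tensorator (deform phi) <->
  is_Xtens phi /\
  forall Ys X Z (s : chain Ys X Z), delta_h phi s = 0.
Proof.
split=> [[_ nat coc idl idr assoc] | [[nat spec dv] dh]].
  split; first split.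
  - move=> [[Y Y'] []] [X X'] [Z Z'] [[k' l'] [k l]] [[f' g'] [f g]].
    move=> [[a' b'] [a b]].
    (* Naturality in C_epsilon is tested on the 2-cells of C, embedded with zero eps-part. *)
    apply: (iffLR (deform_nat _ (a', 0) (b', 0) (a, 0) (b, 0))).
    exact: nat.
  - move=> [Y []] X Z [s1 s2] /= [e | e].
      case: _ _ _ / e s2 => {Y Z s1} -[Y Y'] [f g].
      by case: X f g => X X' f g; exact/deform_idl/idl.
    case: _ _ _ / e s1 => {X Y s2} -[Y Y'] [f g].
    by case: Z f g => Z Z' f g; exact/deform_idr/idr.
  - move=> [[Y [Y' Y'']] []] [X [X' X'']] [Z [Z' Z'']] [[f' [g' h']] [f [g h]]].
    exact/deform_assoc/assoc.
  - move=> [[V V'] [[Y Y'] []]] [X X'] [Z Z'] [[f'' g''] [[f' g'] [f g]]].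
    exact/deform_cocycle/coc.
split.
- by move=> *; exact/iso2_Ceps/(tor_iso (gtorP C)).
- move=> X X' X'' Y Y' Y'' f' k' g' l' f k g l a' b' a b; apply/deform_nat.
  exact: (nat ((X', Y'), tt) (X, Y) (X'', Y'') ((f', g'), (f, g))
    ((k', l'), (k, l)) ((a'.1, b'.1), (a.1, b.1))).
- by move=> *; exact/deform_cocycle/dh.
- move=> X X' Y Y' f g; apply/deform_idl.
  apply: (spec ((X', Y'), tt) (X, Y) (X', Y') ((id1 X', id1 Y'), (f, g))).
  by left; exact: (IsIdn ((X', Y') : obn C 1)).
- move=> X X' Y Y' f g; apply/deform_idr.
  apply: (spec ((X, Y), tt) (X, Y) (X', Y') ((f, g), (id1 X, id1 Y))).
  by right; exact: (IsIdn ((X, Y) : obn C 1)).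
- move=> X X' X'' Y Y' Y'' Z Z' Z'' f' g' h' f g h; apply/deform_assoc.
  exact: dv.
Qed.


(** * Psi-equivalences and coboundaries *)

Definition entry1 (psi : cochain C 1 0) (X X' Y Y' : Ob C)
    (f : hom1 X X') (g : hom1 Y Y') :
    @hom2 K C _ _ (f \ox1 g) (f \ox1 g) :=
  psi tt (X, Y) (X', Y') (f, g).

Definition infinitesimal (psi : cochain C 1 0) : psi_family C :=
  fun X X' Y Y' f g => (id2 (f \ox1 g : @hom1 K C _ _), entry1 psi f g).

Lemma infinitesimal_iso (psi : cochain C 1 0) (X X' Y Y' : Ob (Ceps C))
    (f : hom1 X X') (g : hom1 Y Y') : is_iso2 (infinitesimal psi f g).
Proof.
by apply: iso2_Ceps; exists (id2 _); rewrite /= (vcompidl (g2cat C)).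
Qed.

(** The degree 0 part of the family is an identity, so the eps-part of the tensor product of [a] and
    [b] occurs on both sides and cancels. *)
Lemma infinitesimal_nat (psi : cochain C 1 0) (X X' Y Y' : Ob (Ceps C))
    (f k : hom1 X X') (g l : hom1 Y Y') (a : hom2 f k) (b : hom2 g l) :
  infinitesimal psi k l \v2 (a \ox2 b) = (a \ox2 b) \v2 infinitesimal psi f g
  <->
  entry1 psi k l \v2 @tens2 K C _ _ _ _ _ _ _ _ a.1 b.1 =
  @tens2 K C _ _ _ _ _ _ _ _ a.1 b.1 \v2 entry1 psi f g.
Proof.
rewrite /= !(vcompidl (g2cat C)) !(vcompidr (g2cat C)).
rewrite [X in (_, X) = _]addrC.
by split=> [[=]|-> //]; move/addIr.
Qed.

Lemma infinitesimal_id (psi : cochain C 1 0) (X Y : Ob (Ceps C)) :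
  is_id2 (infinitesimal psi (id1 X) (id1 Y)) <->
  entry1 psi (id1 X) (id1 Y) = 0.
Proof. exact: is_id2_Ceps. Qed.

(** On two composable pairs the three terms have convertible boundaries, so the recasts disappear
    and an ordinary equation results. *)
Lemma delta_h1E (psi : cochain C 1 0) (X X' X'' Y Y' Y'' : Ob C)
    (f' : hom1 X' X'') (g' : hom1 Y' Y'') (f : hom1 X X') (g : hom1 Y Y') :
  delta_h psi (((f', g'), (f, g)) :
    @chain K C 1 1 ((X', Y'), tt) (X, Y) (X'', Y'')) =
  gt f' g' f g \v2 (id2 (f' \ox1 g') \h2 entry1 psi f g)
  + gt f' g' f g \v2 (entry1 psi f' g' \h2 id2 (f \ox1 g))
  - entry1 psi (f' \o1 f) (g' \o1 g) \v2 gt f' g' f g.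
Proof.
rewrite /delta_h big_ord_recl big_ord0 addr0 alternating_sum3 !Theta_pair.
congr (_ + _ - _); apply: eq2_eq; apply: eq2_trans (recastE _ _ _) _ => //.
by apply: eq2_vcomp => //; exact: eq2_Theta.
Qed.

(** In the eps-coefficient, psi occurs on the left at the composite and on the right at each factor;
    collecting these three terms on one side gives [delta_h psi]. *)
Lemma infinitesimal_comp (phi phi' : cochain C 1 1) (psi : cochain C 1 0)
    (X X' X'' Y Y' Y'' : Ob (Ceps C))
    (f' : hom1 X' X'') (g' : hom1 Y' Y'') (f : hom1 X X') (g : hom1 Y Y') :
  infinitesimal psi (f' \o1 f) (g' \o1 g) \v2 tor (deform phi) f' g' f g
      = tor (deform phi') f' g' f g
          \v2 (infinitesimal psi f' g' \h2 id2 (f \ox1 g))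
          \v2 (id2 (f' \ox1 g') \h2 infinitesimal psi f g) <->
  entry phi f' g' f g - entry phi' f' g' f g =
  delta_h psi (((f', g'), (f, g)) :
    @chain K C 1 1 ((X', Y'), tt) (X, Y) (X'', Y'')).
Proof.
rewrite delta_h1E /= hcomp0l hcomp0r addr0 add0r !(hcomp_id2 (g2cat C)).
rewrite !(vcompidl (g2cat C)) !(vcompidr (g2cat C)).
apply: iff_trans (addr_subr_iff _ _ _ _ _).
by split=> [[=]|->].
Qed.

(** In degree 0 both sides are identities. For sequences of length one every Theta_2 in [delta_v] is
    an identity, so only the four values of psi survive. *)
Lemma infinitesimal_assoc (psi : cochain C 1 0)
    (X X' Y Y' Z Z' : Ob (Ceps C))
    (f : hom1 X X') (g : hom1 Y Y') (h : hom1 Z Z') :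
  eq2 ((id2 f \ox2 infinitesimal psi g h) \v2 infinitesimal psi f (g \ox1 h))
      ((infinitesimal psi f g \ox2 id2 h) \v2 infinitesimal psi (f \ox1 g) h)
  <->
  delta_v psi ((f, (g, h)) : @chain K C 2 0 tt (X, (Y, Z)) (X', (Y', Z'))) = 0.
Proof.
apply: iff_trans (eq2_Ceps _) _.
  rewrite /= !(tens2_id2 (gstrict C)) !(vcompidl (g2cat C)).
  exact/eq2_id2/(tens1A (gstrict C)).
rewrite /= !(tens2_id2 (gstrict C)) !(vcompidl (g2cat C)) !(vcompidr (g2cat C)).
rewrite tens20l tens20r addr0 add0r.
rewrite /delta_v !big_ord_recl big_ord0 addr0 alternating_sum4_eq0.
apply: eq2_iff_eq.
  rewrite addrC; apply: eq2_add; apply: eq2_trans (recastE _ _ _) _.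
    apply: eq2_vcomp_idl => //; apply: eq2_trans (recastE _ _ _) _.
    rewrite -(tens2_id2 (gstrict C)); apply: eq2_tens => //.
    exact: recastE.
  exact: eq2_vcomp_idr.
apply: eq2_add; apply: eq2_trans (recastE _ _ _) _.
  apply: eq2_vcomp_idl => //; apply: eq2_trans (recastE _ _ _) _.
  by rewrite -(tens2_id2 (gstrict C)).
exact: eq2_vcomp_idr.
Qed.

Lemma infinitesimal_psi_equiv (t t' : deformation C) (psi : cochain C 1 0) :
  is_psi_equiv t t' (infinitesimal psi) <->
  is_Xtens psi /\ forall Ys X Z (s : chain Ys X Z),
    eps_part t s - eps_part t' s = delta_h psi s.
Proof.
split=> [[_ _ nat id comp assoc] | [[nat spec dv] dh]].
  split; first split.
  - move=> [] [X X'] [Z Z'] [k l] [f g] [a b].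
    apply: (iffLR (infinitesimal_nat _ (a, 0) (b, 0))).
    exact: nat.
  - move=> [] X Z s /= e; case: _ _ _ / e => -[Y Y'].
    exact/infinitesimal_id/id.
  - move=> [] [X [X' X'']] [Z [Z' Z'']] [f [g h]].
    exact/infinitesimal_assoc/assoc.
  - move=> [[Y Y'] []] [X X'] [Z Z'] [[f' g'] [f g]].
    apply: (iffLR (infinitesimal_comp (eps_part t) (eps_part t') psi f' g' f g)).
    (* A deformation is recovered from its eps-part, its degree 0 part being the tensorator of C. *)
    by rewrite !eps_partK; exact: comp.
split.
- by [].
- by move=> *; exact: infinitesimal_iso.
- move=> X X' Y Y' f k g l a b; apply/infinitesimal_nat.
  exact: (nat tt (X, Y) (X', Y') (f, g) (k, l) (a.1, b.1)).
- move=> X Y; apply/infinitesimal_id.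
  by apply: (spec tt (X, Y) (X, Y) (id1 X, id1 Y));
    exact: (IsIdn ((X, Y) : obn C 1)).
- move=> X X' X'' Y Y' Y'' f' g' f g; rewrite -(eps_partK t) -(eps_partK t').
  apply/infinitesimal_comp.
  exact: (dh ((X', Y'), tt) (X, Y) (X'', Y'') ((f', g'), (f, g))).
- by move=> X X' Y Y' Z Z' f g h; apply/infinitesimal_assoc; exact: dv.
Qed.

Lemma psi_equivP (t t' : deformation C) :
  psi_equiv t t' <-> exists2 psi : cochain C 1 0, is_Xtens psi &
    forall Ys X Z (s : chain Ys X Z),
    eps_part t s - eps_part t' s = delta_h psi s.
Proof.
split=> [[psi equiv] | [psi Xpsi dh]]; last first.
  by exists (infinitesimal psi); apply/infinitesimal_psi_equiv.
pose psi1 : cochain C 1 0 := fun _ X Z s => (psi _ _ _ _ s.1 s.2).2.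
(* The condition [psi0] fixes the degree 0 part, so every psi-equivalence has the form 1 + psi1
   eps. *)
have psiE : psi = infinitesimal psi1.
  do 6!(apply: functional_extensionality_dep => ?).
  by rewrite /infinitesimal -(psi0 equiv); exact: surjective_pairing.
move: equiv; rewrite psiE => /infinitesimal_psi_equiv [Xpsi1 dh].
by exists psi1.
Qed.

(** * The bijection on classes *)

Lemma deformation_eps_part (t : deformation C) :
  is_Xtens (eps_part t) /\
  forall Ys X Z (s : chain Ys X Z), delta_h (eps_part t) s = 0.
Proof. by apply/deform_tensorator; rewrite eps_partK; exact: dtorP. Qed.

Definition eps_cocycle (t : deformation C) : Ztens C 1 :=
  Cocycle (deformation_eps_part t).1 (deformation_eps_part t).2.

Definition cocycle_deformation (z : Ztens C 1) : deformation C :=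
  @Deformation K C (deform (Zval z)) (fun _ _ _ _ _ _ _ _ _ _ => erefl)
    (iffRL (deform_tensorator (Zval z))
       (conj (Zval_Xtens z) (@Zval_delta_h _ _ _ z))).

(** Only the underlying cochains are compared, not the proofs stored with them. *)
Lemma cocycle_deformationK z :
  Zval (eps_cocycle (cocycle_deformation z)) = Zval z.
Proof. exact: deformK. Qed.

(** Degree 2 of the complex is index 1, where [is_Btens] unfolds to the existence of the 1-cochain
    psi provided by [psi_equivP]. *)
Lemma psi_equiv_cohomologous (t t' : deformation C) :
  psi_equiv t t' <-> cohomologous (eps_cocycle t) (eps_cocycle t').
Proof. exact: psi_equivP. Qed.

End FirstOrder.

Theorem theorem8p8 (K : comPzRingType) (C : graySemigroup K) :
  exists F : psi_classes C -> Htens C 2, bijective F.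
Proof.
apply: (eq_classes_bijective (f := @eps_cocycle K C)
  (g := @cocycle_deformation K C)).
- exact: psi_equiv_cohomologous.
(* Being cohomologous depends on a cocycle only through [Zval], which the round trip preserves. *)
- by move=> z; apply: funext => z'; rewrite /cohomologous cocycle_deformationK.
- by move=> z z'; rewrite /cohomologous cocycle_deformationK.
Qed.
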